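(* If $(\mathcal{P}(\omega),\subseteq)$ has the $\aleph_1$-FN, then there is no $\aleph_2$-Lusin gap.
   Context: A partial order $P$ has the $\aleph_1$-FN if there is $f:P\to[P]^{<\aleph_1}$ such that whenever $p\leq q$ there is $r\in f(p)\cap f(q)$ with $p\leq r\leq q$. For a regular cardinal $\kappa$, a $\kappa$-Lusin gap is an almost disjoint family $\mathcal{A}\subseteq[\omega]^{\aleph_0}$ (pairwise intersections finite) with $|\mathcal{A}|=\kappa$ such that for every $x\in[\omega]^{\aleph_0}$ either $|\{a\in\mathcal{A}:a\setminus x\text{ finite}\}|<\kappa$ or $|\{a\in\mathcal{A}:a\cap x\text{ finite}\}|<\kappa$. *)

(* Defs.v *)
From mathcomp Require Import all_boot all_order.
From mathcomp Require Import boolp classical_sets functions cardinality.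

Set Implicit Arguments.
Unset Strict Implicit.
Unset Printing Implicit Defensive.

Import Order.TTheory.

Local Open Scope classical_set_scope.
Local Open Scope card_scope.

Definition card_lt (T U : Type) (A : set T) (B : set U) : Prop :=
  A #<= B /\ ~ (B #<= A).

Reserved Notation "A '#<' B" (at level 79, format "A  '#<'  B").
Notation "A '#<' B" := (card_lt A B) : card_scope.

(* |B| = |A|^+, the least cardinal above |A|; a cardinal is represented by an
   arbitrary set of that cardinality, possibly living in another type. *)
Definition is_succ_card (T U : Type) (A : set T) (B : set U) : Prop :=
  A #< B /\ forall (V : Type) (C : set V), A #< C -> B #<= C.

(* |A| = aleph_n *)
Fixpoint is_aleph (n : nat) (T : Type) (A : set T) : Prop :=
  if n is m.+1
  then exists (U : Type) (B : set U), is_aleph m B /\ is_succ_card B A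
  else A #= [set: nat].

(* [P]^{< aleph_1} is the family of countable (possibly finite) subsets. *)
Definition has_aleph1_FN (d : Order.disp_t) (P : porderType d) : Prop :=
  exists f : P -> set P,
    (forall p : P, countable (f p)) /\
    forall p q : P, (p <= q)%O ->
      exists2 r : P, (f p `&` f q) r & (p <= r <= q)%O.

Definition almost_disjoint (A : set (set nat)) : Prop :=
  (forall a : set nat, A a -> infinite_set a) /\
  (forall a b : set nat, A a -> A b -> a <> b -> finite_set (a `&` b)).

(* kappa = |K|; the notion is standardly considered for regular kappa. *)
Definition lusin_gap (U : Type) (K : set U) (A : set (set nat)) : Prop :=
  [/\ almost_disjoint A,
      A #= K
    & forall x : set nat, infinite_set x ->
        [set a | A a /\ finite_set (a `\` x)] #< K \/
        [set a | A a /\ finite_set (a `&` x)] #< K].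

(* Main.v *)
(* Let f witness the aleph_1-FN and let A be an aleph_2-Lusin gap. Write A_r for
   the members of A almost contained in r and D_r for those almost disjoint
   from r ([inside r] and [outside r] in the proof). Call M closed if r in M
   implies f(r \ n) <= M for every n, and A_r (resp. D_r) <= M whenever it has
   size at most aleph_1. Closures of sets of size aleph_1 have size aleph_1, so
   one can choose h(w) in A, for w < omega_1, outside the closure N_w of
   {h(v) : v < w}, and a in A outside the union M of all the N_w.
   The countable set f(omega \ a) & M lies in a single N_w. As h(w) & a is
   finite, h(w) \ n <= omega \ a for some n, and the FN-property gives r in
   f(h(w) \ n) & f(omega \ a), hence r in N_w, with h(w) \ n <= r <= omega \ a.
   Then h(w) in A_r is not in N_w and a in D_r is not in M, so neither A_r nor
   D_r is of size at most aleph_1: r contradicts the gap.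
   All cardinal arithmetic is replaced by the observation that a set has size at
   most aleph_1 iff it is a union of omega_1 many countable sets. *)
Require Import Defs.
From mathcomp Require Import all_boot all_order.
From mathcomp Require Import boolp classical_sets functions cardinality.
From mathcomp Require Import wochoice.
From Stdlib Require Import Inverse_Image.

Set Implicit Arguments.
Unset Strict Implicit.
Unset Printing Implicit Defensive.

Local Open Scope classical_set_scope.
Local Open Scope card_scope.

(** * Orders of type omega_1 and recursion along them *)

Definition omega1_order (W : Type) (lt : W -> W -> Prop) : Prop :=
  [/\ well_founded lt,
      forall x y z, lt x y -> lt y z -> lt x z,
      forall x y, [\/ lt x y, x = y | lt y x],
      forall w, countable [set v | lt v w]
    & ~ countable [set: W]].

Lemma countableU (T : Type) (X Y : set T) :
  countable X -> countable Y -> countable (X `|` Y).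
Proof.
move=> cX cY; rewrite (_ : X `|` Y = \bigcup_b (if b then X else Y)).
  by apply: bigcup_countable => // -[].
apply/seteqP; split=> [x [Xx|Yx]|x [[] _]] /=; [by exists true|by exists false|..].
- by left.
- by right.
Qed.

Lemma countable_image (T U : Type) (g : T -> U) (X : set T) :
  countable X -> countable (g @` X).
Proof. exact/sub_countable/card_image_le. Qed.

Lemma uncountable_nonempty (T : Type) (X : set T) : ~ countable X -> X !=set0.
Proof. by move=> ucX; apply/set0P/eqP => X0; apply: ucX; rewrite X0. Qed.

(** Transfinite recursion: at stage [w] the earlier values form a countable set, so [Phi] still
    offers a value. *)
Lemma wf_choose (W T : Type) (lt : W -> W -> Prop) (Phi : set T -> set T) :
  well_founded lt -> (forall w, countable [set v | lt v w]) ->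
  (forall X, countable X -> Phi X !=set0) ->
  exists h : W -> T, forall w, Phi (h @` [set v | lt v w]) (h w).
Proof.
move=> wf clt Phi0.
have Phi1 w (rec : forall v, lt v w -> T) :
    exists x, Phi [set y | exists v (H : lt v w), y = rec v H] x.
  apply: Phi0.
  pose g (v : [set v | lt v w]) := rec (val v) (set_mem (valP v)).
  rewrite (_ : [set y | _] = range g).
    by apply: countable_image; rewrite (eq_countable (card_setT _)).
  apply/seteqP; split=> [_ [v [H ->]]|_ [v _ <-]] /=.
  - exists (SigSub (mem_set H) : [set v | lt v w]) => //.
    by rewrite /g /=; congr rec; exact: Prop_irrelevance.
  - by exists (val v), (set_mem (valP v)).
pose step w rec := projT1 (cid (Phi1 w rec)).
exists (Fix wf (fun=> T) step) => w.
rewrite Fix_eq; last first.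
  move=> x f g fg; congr step.
  by do 2! apply: functional_extensionality_dep => ?.
rewrite /step; case: cid => y /=.
congr Phi; apply/seteqP; split=> [_ [v [H ->]]|_ [v H <-]] /=.
- by exists v.
- by exists v, H.
Qed.

(** Picking for each point an element of [B] not taken by its countably many predecessors never
    exhausts [B]; comparability within [X] makes the choice injective there. *)
Lemma wf_inj_uncountable (T U : Type) (lt : T -> T -> Prop) (X : set T)
    (B : set U) :
  well_founded lt -> (forall y, countable [set x | lt x y]) ->
  (forall x y, X x -> X y -> x <> y -> lt x y \/ lt y x) ->
  ~ countable B -> X #<= B.
Proof.
move=> wf clt tot ucB.
have [|h hP] := @wf_choose T U lt (fun Y => B `\` Y) wf clt.
  move=> Y cY; apply/set0P/eqP; rewrite setD_eq0 => BY; apply: ucB.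
  exact: sub_countable (subset_card_le BY) cY.
apply: card_le_trans (subset_card_le (_ : h @` X `<=` B)).
  have hinj : set_inj X h.
    move=> x y /set_mem Xx /set_mem Xy hxy; apply: contrapT => /(tot _ _ Xx Xy)[] l.
    - by case: (hP y) => _; apply; exists x.
    - by case: (hP x) => _; apply; exists y.
  by have /card_eqPle[] := inj_card_eq hinj.
by move=> _ [x _ <-]; case: (hP x).
Qed.

(** Well-order [T] and keep the points with countably many predecessors. Were these only countably
    many, induction would put every point among them, making [T] countable. *)
Lemma omega1_order_exists (T : Type) : ~ countable [set: T] ->
  exists (W : Type) (lt : W -> W -> Prop),
    omega1_order lt /\ [set: W] #<= [set: T].
Proof.
elim/Pchoice: T => T ucT.
have [R Rwo] := well_ordering_principle T.
have Rch : wo_chain R predT by exact: withinW.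
have Ranti x y : R x y -> R y x -> x = y.
  by move=> xy yx; apply: (wo_chain_antisymmetric Rch) => //; rewrite xy.
have Rtot x y : R x y \/ R y x by apply/orP; exact: (wo_chainW Rch).
pose lt x y := R x y /\ x <> y.
have lt_wf : well_founded lt.
  move=> x; apply: contrapT => nx.
  have [|z [[/asboolP nz zl] _]] := Rwo [pred u | `[< ~ Acc lt u >]].
    by exists x; apply/asboolP.
  apply: nz; constructor=> y [yz nyz]; apply: contrapT => ny.
  by apply/nyz/Ranti => //; apply: zl; apply/asboolP.
have lt_tot x y : [\/ lt x y, x = y | lt y x].
  have [->|/eqP xy] := eqVneq x y; first exact: Or32.
  by have [?|?] := Rtot x y; [apply: Or31|apply: Or33]; split => // /esym.
have lt_asym x y : lt x y -> ~ lt y x.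
  by move=> [xy nxy] [yx _]; apply/nxy/Ranti.
have lt_trans x y z : lt x y -> lt y z -> lt x z.
  move=> xy yz; have [//|xz|zx] := lt_tot x z.
    by move: xy; rewrite xz => /lt_asym.
  exfalso.
  (* A cycle x < y < z < x would leave {x, y, z} without a least element. *)
  have [|m [[mA ml] _]] := Rwo [pred u | [|| u == x, u == y | u == z]].
    by exists x; rewrite inE eqxx.
  have min_absurd a b : lt a b -> a \in [pred u | [|| u == x, u == y | u == z]] ->
      m <> b.
    by move=> [ab nab] /ml ma mb; apply/nab/Ranti => //; rewrite -mb.
  move: mA; rewrite inE => /or3P[]/eqP.
  - by apply: min_absurd zx _; rewrite inE eqxx !orbT.
  - by apply: min_absurd xy _; rewrite inE eqxx.
  - by apply: min_absurd yz _; rewrite inE eqxx !orbT.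
pose W := [set x | countable [set y | lt y x]].
have ucW : ~ countable W.
  move=> cW.
  have [x nWx] : exists x, ~ W x.
    apply: contrapT => nex; apply: ucT; apply: sub_countable cW.
    by apply: subset_card_le => x _; apply: contrapT => nWx; apply: nex; exists x.
  elim/(well_founded_ind lt_wf): x nWx => x IH; apply.
  apply: sub_countable cW; apply: subset_card_le => y yx.
  by apply: contrapT => /(IH _ yx).
exists (set_type W), (fun v w => lt (val v) (val w)); split; last first.
  by rewrite (card_le_eql (card_setT _)); exact: card_leT.
split.
- exact: (wf_inverse_image _ _ _ val lt_wf).
- by move=> x y z; exact: lt_trans.
- move=> x y; have [?|/val_inj->|?] := lt_tot (val x) (val y).
  + exact: Or31.
  + exact: Or32.
  + exact: Or33.
- move=> w; have cw : countable [set y | lt y (val w)] by exact: (set_mem (valP w)).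
  apply: sub_countable cw; apply: card_le_trans (subset_card_le _).
    have vi : set_inj [set v : set_type W | lt (val v) (val w)] val.
      by move=> ? ? _ _; exact: val_inj.
    by have /card_eqPle[_] := inj_card_eq vi; exact.
  by move=> _ [v + <-].
- by rewrite (eq_countable (card_setT _)).
Qed.

(** Regularity of omega_1: an unbounded countable [D] would cover [W] by countably many countable
    initial segments. *)
Lemma omega1_order_bounded (W : Type) (lt : W -> W -> Prop) (D : set W) :
  omega1_order lt -> countable D -> exists w, forall v, D v -> lt v w.
Proof.
move=> [_ _ tot clt ucW] cD; apply: contrapT => unbd; apply: ucW.
have cU : countable (\bigcup_(v in D) ([set u | lt u v] `|` [set v])).
  apply: bigcup_countable => // v _.
  by apply: countableU; [exact: clt | exact: countable1].
apply: sub_countable cU; apply: subset_card_le => w _.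
apply: contrapT => nw; apply: unbd; exists w => v Dv.
have [//|vw|wv] := tot v w; case: nw; exists v => //.
- by right.
- by left.
Qed.

(** * Sets of size at most aleph_1 as unions of countable sets *)

(* Meaningful when [W] carries an [omega1_order]: then it says |X| <= aleph_1. *)
Definition small (W T : Type) (X : set T) : Prop :=
  exists F : W -> set T,
    (forall w, countable (F w)) /\ X `<=` \bigcup_w F w.

Lemma sub_small (W T : Type) (X Y : set T) :
  X `<=` Y -> small W Y -> small W X.
Proof. by move=> XY [F [cF YF]]; exists F; split=> //; apply: subset_trans YF. Qed.

Lemma countable_small (W T : Type) (w : W) (X : set T) :
  countable X -> small W X.
Proof. by move=> cX; exists (fun=> X); split=> // x Xx; exists w. Qed.

Lemma smallU (W T : Type) (X Y : set T) :
  small W X -> small W Y -> small W (X `|` Y).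
Proof.
move=> [F [cF XF]] [G [cG YG]]; exists (fun w => F w `|` G w).
split=> [w|x [/XF|/YG] [w _ Fx]]; first exact: countableU.
- by exists w => //; left.
- by exists w => //; right.
Qed.

Lemma card_le_small (W T : Type) (X : set T) : X #<= [set: W] -> small W X.
Proof.
move=> /card_leP[i].
exists (fun w => [set x | exists H : X x, val (i (SigSub (mem_set H))) = w]).
split=> [w|x Xx]; last by exists (val (i (SigSub (mem_set Xx)))) => //; exists Xx.
apply/countable_injP; exists (fun=> 0) => x y.
move=> /set_mem[Xx <-] /set_mem[Xy] /val_inj ixy _.
have iinj := 'inj_i; by have := iinj _ _ (mem_set I) (mem_set I) ixy => /(congr1 val).
Qed.

(** Order [X] lexicographically, by an index [rho x] of a piece containing [x], then by an
    enumeration of that piece. Predecessors of a point lie in countably many countable pieces, so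
    [wf_inj_uncountable] applies. *)
Lemma small_card_le (W T U : Type) (lt : W -> W -> Prop) (X : set T)
    (B : set U) :
  omega1_order lt -> small W X -> ~ countable B -> X #<= B.
Proof.
move=> Wlt [F [cF XF]] ucB; have [wf _ tot clt ucW] := Wlt.
have [w0 _] := uncountable_nonempty ucW.
have /choice[rho rhoP] x : exists w, X x -> F w x.
  by have [/XF[w _ Fx]|nXx] := EM (X x); [exists w|exists w0].
have /choice[g gP] w : exists g : T -> nat, set_inj (F w) g.
  exact/countable_injP.
pose R x y := [/\ X x, X y &
  lt (rho x) (rho y) \/ rho x = rho y /\ g (rho x) x < g (rho y) y].
apply: (@wf_inj_uncountable _ _ R _ _ _ _ _ ucB).
- move=> x; have [w rx] : exists w, rho x = w by exists (rho x).
  elim/(well_founded_ind wf): w x rx => w IHw x rx.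
  have [n le_n] : exists n, g (rho x) x < n by exists (g (rho x) x).+1.
  elim: n x rx le_n => [x _|n IHn x rx gn]; first by rewrite ltn0.
  constructor => y [_ _ [yx|[yx gyx]]].
  + by apply: (IHw _ _ _ erefl); rewrite -rx.
  + by apply: IHn; [rewrite yx | exact: leq_trans gyx gn].
- move=> y.
  have cU : countable (\bigcup_(w in [set w | lt w (rho y)] `|` [set rho y]) F w).
    apply: bigcup_countable => //.
    by apply: countableU; [exact: clt|exact: countable1].
  apply: sub_countable cU; apply: subset_card_le => x [Xx _ xy].
  exists (rho x); last exact: rhoP.
  by case: xy => [|[->]]; [left|right].
- move=> x y Xx Xy xy.
  have [l|e|l] := tot (rho x) (rho y); [by left; split=> //; left| |
                                        by right; split=> //; left].
  have [l|l|e'] := ltngtP (g (rho x) x) (g (rho y) y).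
  + by left; split=> //; right.
  + by right; split=> //; right.
  + case: xy; apply: (gP (rho x)) => //.
    * by apply/mem_set/rhoP.
    * by apply/mem_set; rewrite e; exact: rhoP.
    * by rewrite e' e.
Qed.

(** * Closures under set-valued maps *)

Inductive closure (T : Type) (G : T -> set T) (S : set T) : set T :=
| closure_base x : S x -> closure G S x
| closure_step c x : closure G S c -> G c x -> closure G S x.

Lemma closureS (T : Type) (G H : T -> set T) (S R : set T) :
  (forall c, G c `<=` H c) -> S `<=` R -> closure G S `<=` closure H R.
Proof.
move=> GH SR x; elim=> [y /SR|c y _ Hc /GH]; first exact: closure_base.
exact: closure_step.
Qed.

Lemma closure_countable (T : Type) (G : T -> set T) (S : set T) :
  (forall c, countable (G c)) -> countable S -> countable (closure G S).
Proof.
move=> cG cS; pose N n := iter n (fun Y => \bigcup_(c in Y) G c) S.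
have cN : countable (\bigcup_n N n).
  apply: bigcup_countable => // n _; elim: n => //= n IHn.
  exact: bigcup_countable.
apply: sub_countable cN; apply: subset_card_le => x.
elim=> [y Sy|c y _ [n _ Nc] Gy]; first by exists 0.
by exists n.+1 => //=; exists c.
Qed.

(** Truncating [S] and every [G c] at an index [w] leaves countable data, hence a countable closure
    [N w]. These increase and exhaust the closure: a step involves two indices, and the larger
    serves for both. *)
Lemma closure_small (W T : Type) (lt : W -> W -> Prop) (G : T -> set T)
    (S : set T) :
  omega1_order lt -> (forall c, small W (G c)) -> small W S ->
  small W (closure G S).
Proof.
move=> Wlt sG [FS [cFS SFS]]; have [_ ltr tot clt _] := Wlt.
have [FG /all_and2[cFG GFG]] := choice sG.
(* [le w] is the closed initial segment up to [w], so [le u v] says that [v] is at most [u]. *)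
pose le w := [set v | lt v w] `|` [set w].
have cle w : countable (le w).
  by apply: countableU; [exact: clt | exact: countable1].
have le_trans u v w : le u v -> le v w -> le u w.
  by move=> [vu|->//] [wv|->]; left => //; exact: ltr vu.
pose below (E : W -> set T) w := \bigcup_(v in le w) E v.
pose N w := closure (fun c => below (FG c) w) (below FS w).
have below_mono E u v : le u v -> below E v `<=` below E u.
  by move=> vu x [w wv Ex]; exists w => //; exact: le_trans wv.
have Nmono u v : le u v -> N v `<=` N u.
  by move=> vu; apply: closureS => [c|]; exact: below_mono.
exists N; split=> [w|x].
  by apply: closure_countable => [c|]; exact: bigcup_countable.
elim=> [y /SFS[w _ Fy]|c y _ [v _ Nc] /GFG[w _ Fy]].
  by exists w => //; apply: closure_base; exists w => //; right.
have [u vu wu] : exists2 u, le u v & le u w.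
  have [vw|->|wv] := tot v w.
  - by exists w; [left|right].
  - by exists w; right.
  - by exists v; [right|left].
by exists u => //; apply: (closure_step (Nmono _ _ vu _ Nc)); exists w.
Qed.

(** * From aleph_2 to smallness, and the theorem *)

Lemma aleph2_small (U : Type) (K : set U) : is_aleph 2 K ->
  exists (W : Type) (lt : W -> W -> Prop), omega1_order lt /\
    forall (T : Type) (X : set T),
      (X #< K -> small W X) /\ (small W X -> ~ (K #<= X)).
Proof.
move=> [U1 [B [[U0 [B0 [B0nat [[_ nBB0] B_least]]]] [[_ nKB] K_least]]]].
have ucB : ~ countable B by rewrite /countable -(card_le_eqr B0nat).
have [|W [lt [Wlt WB]]] := @omega1_order_exists (set_type B).
  by rewrite (eq_countable (card_setT _)).
exists W, lt; split=> // T X; have [_ _ _ _ ucW] := Wlt.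
have B_least' V (C : set V) : ~ countable C -> B #<= C.
  move=> ucC; apply: B_least; split; rewrite (card_le_eql B0nat, card_le_eqr B0nat)//.
  by apply/infiniteP => /finite_set_countable.
split=> [[_ nKX]|sX KX].
- apply/card_le_small/(card_le_trans _ (B_least' _ _ ucW)).
  (* If [X] did not embed in [B], it would lie strictly above [B], hence be at least as large as
     [K]. *)
  apply: contrapT => nXB; apply: nKX; apply: K_least; split=> //.
  apply: B_least' => cX; apply: nXB; apply: card_le_trans cX _.
  by apply/infiniteP => /finite_set_countable.
- by apply: nKB; apply: card_le_trans KX (small_card_le Wlt sX ucB).
Qed.

Lemma finite_set_tail (b : set nat) : finite_set b ->
  exists n, b `&` [set k | n <= k] = set0.
Proof.
move=> /finite_seqP[s ->]; exists (\max_(k <- s) k).+1.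
apply/seteqP; split=> // k [/= ks]; rewrite ltnNge.
by rewrite leq_bigmax_seq.
Qed.

Theorem theorem6p1 (U : Type) (K : set U) (hK : is_aleph 2 K)
  (hFN : has_aleph1_FN (set nat)) :
  ~ exists A : set (set nat), lusin_gap K A.
Proof.
have [f [cf fP]] := hFN.
have [W [lt [Wlt cardW]]] := aleph2_small hK.
move=> [A [[A_inf A_ad] AK gap]].
have [wf _ _ clt ucW] := Wlt.
have [w0 _] := uncountable_nonempty ucW.
pose tail n (b : set nat) := b `&` [set k | n <= k].
pose inside r := [set a | A a /\ finite_set (a `\` r)].
pose outside r := [set a | A a /\ finite_set (a `&` r)].
(* The size conditions sit inside the comprehensions, which become empty when they fail; this keeps
   every [G c] small. *)
pose G c := \bigcup_n f (tail n c)
  `|` ([set b | inside c #< K /\ inside c b] `|` [set b | outside c #< K /\ outside c b]).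
have sG c : small W (G c).
  apply: smallU; first by apply: (countable_small w0); apply: bigcup_countable.
  have sI (X : set (set nat)) : small W [set b | X #< K /\ X b].
    have [/(cardW _ X).1|nXK] := EM (X #< K); first by apply: sub_small => b [].
    by apply: (countable_small w0); rewrite (_ : [set b | _] = set0)//;
      apply/seteqP; split=> // b [].
  by apply: smallU; exact: sI.
pose M := closure G.
have A_nsmall X : small W X -> exists2 a, A a & ~ X a.
  move=> sX; apply: contrapT => nA; apply: ((cardW _ X).2 sX).
  rewrite -(card_le_eql AK); apply: subset_card_le => a Aa.
  by apply: contrapT => nXa; apply: nA; exists a.
have [|h hP] := @wf_choose W _ lt (fun S => A `\` M S) wf clt.
  move=> S /(countable_small w0) sS.
  have [a Aa nMa] := A_nsmall _ (closure_small Wlt sG sS).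
  by exists a.
pose N w := M (h @` [set v | lt v w]).
have NS v w : lt v w -> N v `<=` N w.
  have [_ ltr _ _ _] := Wlt.
  move=> vw; apply: closureS => [c x|_ [u uv <-]] //.
  by exists u => //; exact: ltr uv vw.
have hN v w : lt v w -> N w (h v) by move=> vw; apply: closure_base; exists v.
have [a Aa naN] : exists2 a, A a & ~ (\bigcup_w N w) a.
  apply/A_nsmall/(@sub_small _ _ _ (M (range h))).
    by move=> x [w _]; apply: closureS => [c y|_ [v _ <-]] //; exists v.
  by apply/(closure_small Wlt sG)/card_le_small/card_image_le.
(* [rk r] names a stage containing [r], with junk value [w0] if there is none. Bounding it over a
   countable set traps in one stage all members that lie in any stage. *)
have /choice[rk rkP] r : exists w, (\bigcup_w N w) r -> N w r.
  by have [[w _ Nr]|nNr] := EM ((\bigcup_w N w) r); [exists w|exists w0].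
have [w wP] := omega1_order_bounded Wlt (countable_image rk (cf (~` a))).
(* [h w] is not in [N w]; the later stage [N w'] contains it. *)
have [w' /(_ w erefl) ww'] := omega1_order_bounded Wlt (countable1 w).
have [Ahw nNhw] := hP w.
have hwa : h w <> a by move=> ha; apply: naN; exists w' => //; rewrite -ha; exact: hN.
have [n tail0] := finite_set_tail (A_ad _ _ Ahw Aa hwa).
have : tail n (h w) `<=` ~` a.
  by move=> k [hk nk] ak; have : (set0 : set nat) k by rewrite -tail0.
rewrite -subsetEset => /fP[r [fr1 fr2] /andP[]]; rewrite !subsetEset => hr ra.
(* Membership in [f (tail n (h w))] puts [r] in [N w'], so its rank is genuine; membership in the
   other value of [f] puts that rank below [w]. *)
have Nr : N w r.
  apply: (NS (rk r)); first by apply: wP; exists r.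
  apply: rkP; exists w' => //; apply: (closure_step (hN _ _ ww')).
  by left; exists n.
have hw_inside : inside r (h w).
  split=> //; apply: (@sub_finite_set _ _ `I_n); last exact: finite_II.
  move=> k [hk nrk] /=; rewrite ltnNge; apply/negP => nk.
  by apply: nrk; apply: hr.
have a_outside : outside r a.
  split=> //; rewrite (_ : a `&` r = set0)//.
  by apply/seteqP; split=> // k [ak /ra].
have r_inf : infinite_set r.
  move=> r_fin; apply: (A_inf _ Ahw); rewrite -(setUIDK (h w) r).
  rewrite finite_setU; split; last exact: hw_inside.2.
  exact: sub_finite_set r_fin.
(* Whichever set is smaller than [K], [N w] absorbs it, and with it [h w] or [a], against their
   choice. *)
case: (gap r r_inf) => [lt_inside|lt_outside].
- by apply: nNhw; apply: (closure_step Nr); right; left.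
- by apply: naN; exists w => //; apply: (closure_step Nr); right; right.
Qed.
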